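(* Let $\mathbb{A}$ be an associative unital algebra over an algebraically closed field $\Bbbk$ of characteristic zero, equipped with an $\mathrm{id}$-adapted double transposed Poisson algebra structure $\llbracket-,-\rrbracket^{(r,s)}:\mathbb{A}^{\otimes r}\otimes\mathbb{A}^{\otimes s}\to\mathbb{A}^{\otimes(r+s)}$, $r,s\ge1$. Let $\mathrm m:\mathbb{A}\otimes\mathbb{A}\to\mathbb{A}$ be the multiplication. Then the map $D:\mathbb{A}\to\mathbb{A}$ given by $$D(\alpha)=\mathrm m\,\llbracket1,\alpha\rrbracket^{(1,1)},\qquad\alpha\in\mathbb{A},$$ is a derivation of $\mathbb{A}$, and for all $r,s\ge1$, $\alpha\in\mathbb{A}^{\otimes r}$, $\beta\in\mathbb{A}^{\otimes s}$, $$\llbracket\alpha,\beta\rrbracket^{(r,s)}=\alpha\otimes D(\beta)-D(\alpha)\otimes\beta,$$ where $D$ is extended to tensor powers by $D(a^1\otimes\cdots\otimes a^n)=\sum_{k=1}^n a^1\otimes\cdots\otimes D(a^k)\otimes\cdots\otimes a^n$.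
   Context: Tensor products are over $\Bbbk$. Notation on tensor powers. For $1\le u<v\le r$, $\mathrm m_{u,v}:\mathbb{A}^{\otimes r}\to\mathbb{A}^{\otimes(r-1)}$ removes the $u$-th factor $a^u$ and replaces the $v$-th factor $a^v$ by $a^ua^v$. For $0\le\rho\le r$, $b\otimes_\rho(a^1\otimes\cdots\otimes a^r)=a^1\otimes\cdots\otimes a^\rho\otimes b\otimes a^{\rho+1}\otimes\cdots\otimes a^r$ ($b$ is placed first if $\rho=0$). For $\sigma\in S_\ell$, $\tau_\sigma^{m_1,\dots,m_\ell}$ cuts a tensor into consecutive blocks of lengths $m_1,\dots,m_\ell$ and moves the $k$-th block to position $\sigma(k)$, any remaining factors being left in place; e.g. $\tau_{(12)}^{r,s}(\alpha\otimes\beta\otimes\gamma)=\beta\otimes\alpha\otimes\gamma$, $\tau_{(123)}^{r,s,t}(\alpha\otimes\beta\otimes\gamma)=\gamma\otimes\alpha\otimes\beta$ for $\alpha,\beta,\gamma$ of degrees $r,s,t$. When it acts on a tensor with a first block of length $r$, $\tau_{(23)}^{t,s}$ swaps the second and third blocks, of lengths $t,s$. $\mathrm{id}$-adapted double transposed Poisson algebra: an associative unital algebra $\mathbb{A}$ with $\Bbbk$-linear maps $\llbracket-,-\rrbracket^{(r,s)}:\mathbb{A}^{\otimes r}\otimes\mathbb{A}^{\otimes s}\to\mathbb{A}^{\otimes(r+s)}$, $r,s\ge1$, such that for all $\alpha\in\mathbb{A}^{\otimes r},\beta\in\mathbb{A}^{\otimes s},\gamma\in\mathbb{A}^{\otimes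 t}$ ($r,s,t\ge1$): (1) $\llbracket\alpha,\beta\rrbracket^{(r,s)}=-\tau_{(12)}^{s,r}\llbracket\beta,\alpha\rrbracket^{(s,r)}$; (2) $\llbracket\alpha,\llbracket\beta,\gamma\rrbracket^{(s,t)}\rrbracket^{(r,s+t)}+\tau_{(123)}^{s,t,r}\llbracket\beta,\llbracket\gamma,\alpha\rrbracket^{(t,r)}\rrbracket^{(s,r+t)}+\tau_{(132)}^{t,r,s}\llbracket\gamma,\llbracket\alpha,\beta\rrbracket^{(r,s)}\rrbracket^{(t,r+s)}=0$; (3) $2\gamma\otimes\llbracket\alpha,\beta\rrbracket^{(r,s)}=\llbracket\gamma\otimes\alpha,\beta\rrbracket^{(t+r,s)}+\tau_{(12)}^{r,t}\llbracket\alpha,\gamma\otimes\beta\rrbracket^{(r,t+s)}$; (4) $2\llbracket\alpha,\beta\rrbracket^{(r,s)}\otimes\gamma=\tau_{(132)}^{t,r,s}\llbracket\gamma\otimes\alpha,\beta\rrbracket^{(t+r,s)}+\tau_{(23)}^{t,s}\llbracket\alpha,\gamma\otimes\beta\rrbracket^{(r,t+s)}$; (5) $\llbracket1,\beta\rrbracket^{(1,s)}\in\Bbbk1\otimes\mathbb{A}^{\otimes s}\subset\mathbb{A}^{\otimes(s+1)}$; (6) $\llbracket1\otimes_\rho\alpha,\beta\rrbracket^{(r+1,s)}=1\otimes_\rho\llbracket\alpha,\beta\rrbracket^{(r,s)}$ and $\llbracket\alpha,1\otimes_\varsigma\beta\rrbracket^{(r,s+1)}=1\otimes_{r+\varsigma}\llbracket\alpha,\beta\rrbracket^{(r,s)}$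 for $0\le\rho\le r$, $0\le\varsigma\le s$; (7) $\llbracket\mathrm m_{\rho,\rho+1}\alpha,\beta\rrbracket^{(r-1,s)}=\mathrm m_{\rho,\rho+1}\llbracket\alpha,\beta\rrbracket^{(r,s)}$ and $\llbracket\alpha,\mathrm m_{\varsigma,\varsigma+1}\beta\rrbracket^{(r,s-1)}=\mathrm m_{r+\varsigma,r+\varsigma+1}\llbracket\alpha,\beta\rrbracket^{(r,s)}$ for $1\le\rho\le r-1$, $1\le\varsigma\le s-1$; (8) for $m_1,\dots,m_\ell>0$ with sum $s$ and $\sigma\in S_\ell$: $\llbracket\alpha,\tau_\sigma^{m_1,\dots,m_\ell}\beta\rrbracket^{(r,s)}=\tau_{\widehat\sigma}^{r,m_1,\dots,m_\ell}\llbracket\alpha,\beta\rrbracket^{(r,s)}$ and $\llbracket\tau_\sigma^{m_1,\dots,m_\ell}\beta,\alpha\rrbracket^{(s,r)}=\tau_\sigma^{m_1,\dots,m_\ell}\llbracket\beta,\alpha\rrbracket^{(s,r)}$, where $\widehat\sigma=\mathrm{id}_1\times\sigma\in S_{\ell+1}$ fixes the first block. *)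

(* Defs.v *)
From HB Require Import structures.
From mathcomp Require Import all_fingroup all_boot all_order all_algebra.
From mathcomp Require Import boolp finmap.
From mathcomp.multinomials Require Import monalg.

Set Implicit Arguments.
Unset Strict Implicit.
Unset Printing Implicit Defensive.

Import GRing.Theory.
Local Open Scope ring_scope.
Local Open Scope quotient_scope.

(* Tensor powers of a module: the free module on V^n modulo the submodule
   generated by the multilinearity relations. *)
Section TensorPower.
Variables (k : comNzRingType) (V : lmodType k) (n : nat).

Definition upd (a : {ffun 'I_n -> V}) (i : 'I_n) (x : V) : {ffun 'I_n -> V} :=
  [ffun j => if j == i then x else a j].

Definition multilinear (W : lmodType k) (f : {ffun 'I_n -> V} -> W) : Prop :=
  forall a i (c : k) (x y : V),
    f (upd a i (c *: x + y)) = c *: f (upd a i x) + f (upd a i y).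

Local Notation F := {malg k[{ffun 'I_n -> V}]}.

Definition multilinear_relator a i (c : k) (x y : V) : F :=
  << upd a i (c *: x + y) >> - (c *: << upd a i x >> + << upd a i y >>).

Definition relators : {pred F} := fun z =>
  `[< forall S : {pred F}, submod_closed S ->
      (forall a i c x y, multilinear_relator a i c x y \in S) -> z \in S >].

Lemma relators_submod_closed : submod_closed relators.
Proof.
split; first by apply/asboolP => S [].
move=> c u v /asboolP uN /asboolP vN; apply/asboolP => S subS relS.
by apply: subS.2; [exact: uN | exact: vN].
Qed.

HB.instance Definition _ :=
  GRing.isSubmodClosed.Build k F relators relators_submod_closed.

Definition tpow : Type := Quotient.quot (relators : zmodClosed _).
HB.instance Definition _ := Choice.on tpow.
HB.instance Definition _ := GRing.Zmodule.on tpow.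

Definition tpi (z : F) : tpow := \pi_(Quotient.quot (relators : zmodClosed _)) z.

Lemma tpi_eq x y : (x - y \in relators) = (tpi x == tpi y).
Proof. exact: Quotient.idealrBE. Qed.

Lemma tpi_repr (t : tpow) : tpi (repr (t : Quotient.quot _)) = t.
Proof. exact: reprK. Qed.

Lemma tpiD x y : tpi (x + y) = tpi x + tpi y.
Proof. by rewrite /tpi piE. Qed.

Definition tscale (c : k) (t : tpow) : tpow :=
  tpi (c *: repr (t : Quotient.quot _)).

Lemma tscale_pi c x : tscale c (tpi x) = tpi (c *: x).
Proof.
apply/eqP; rewrite -tpi_eq -scalerBr rpredZ // tpi_eq.
by rewrite tpi_repr.
Qed.

Lemma tscaleA a b t : tscale a (tscale b t) = tscale (a * b) t.
Proof. by rewrite -[t]tpi_repr !tscale_pi scalerA. Qed.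
Lemma tscale1 : left_id 1 tscale.
Proof. by move=> t; rewrite -[t]tpi_repr !tscale_pi scale1r. Qed.
Lemma tscaleDr : right_distributive tscale +%R.
Proof.
move=> c s t; rewrite -[t]tpi_repr -[s]tpi_repr.
by rewrite -tpiD !tscale_pi -tpiD scalerDr.
Qed.
Lemma tscaleDl t : {morph tscale^~ t : a b / a + b}.
Proof. by move=> a b; rewrite -[t]tpi_repr !tscale_pi -tpiD scalerDl. Qed.

HB.instance Definition _ := GRing.Zmodule_isLmodule.Build k tpow
  tscaleA tscale1 tscaleDr tscaleDl.

Lemma tpi_linear : linear tpi.
Proof. by move=> c x y; rewrite tpiD -tscale_pi. Qed.

HB.instance Definition _ := GRing.isLinear.Build k F tpow _ tpi tpi_linear.

Definition pure (a : {ffun 'I_n -> V}) : tpow := tpi << a >>.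

Lemma pure_multilinear : multilinear pure.
Proof.
move=> a i c x y; rewrite /pure -linearP.
apply/eqP; rewrite -tpi_eq; apply/asboolP => S _; exact.
Qed.

Section Lift.
Variables (W : lmodType k) (f : {ffun 'I_n -> V} -> W).

Definition free_lift (z : F) : W := \sum_(a <- msupp z) z@_a *: f a.

Lemma free_liftEw (D : {fset {ffun 'I_n -> V}}) (z : F) :
  (msupp z `<=` D)%fset -> free_lift z = \sum_(a <- D) z@_a *: f a.
Proof.
move=> sD; rewrite /free_lift (big_fset_incl _ sD) //= => a _.
by move=> /mcoeff_outdom ->; rewrite scale0r.
Qed.

Lemma free_lift_linear : linear free_lift.
Proof.
move=> c x y; pose D := (msupp x `|` msupp y `|` msupp (c *: x + y))%fset.
rewrite !(@free_liftEw D) ?fsubsetUr //; last first.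
- by rewrite /D -fsetUA fsubsetUl.
- by rewrite /D fsetUAC fsubsetUr.
rewrite scaler_sumr -big_split /=; apply: eq_bigr => a _.
by rewrite mcoeffD mcoeffZ scalerDl scalerA.
Qed.

HB.instance Definition _ := GRing.isLinear.Build k F W _ free_lift
  free_lift_linear.

Lemma free_liftU a : free_lift << a >> = f a.
Proof.
by rewrite /free_lift msuppU oner_eq0 big_seq_fset1 mcoeffUU scale1r.
Qed.

Lemma free_lift_relators z : multilinear f -> z \in relators -> free_lift z = 0.
Proof.
move=> fP /asboolP zN; apply/eqP.
apply: (zN (fun z => free_lift z == 0)).
  split=> [|c x y]; rewrite !unfold_in ?linear0 // => /eqP x0 /eqP y0.
  by rewrite linearP /= x0 y0 scaler0 addr0.
move=> a i c x y; rewrite unfold_in /multilinear_relator.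
rewrite linearB /= linearP /= !free_liftU fP.
by rewrite subrr.
Qed.

(* Junk value 0 if f is not multilinear; for the operations below, the lemmas
   ending in _multilinear show when this does not occur. *)
Definition tlift (t : tpow) : W :=
  if `[< multilinear f >] then free_lift (repr (t : Quotient.quot _)) else 0.

Lemma tlift_pi z : multilinear f -> tlift (tpi z) = free_lift z.
Proof.
move=> fP; rewrite /tlift asboolT //; apply/eqP.
by rewrite -subr_eq0 -linearB /= free_lift_relators // tpi_eq tpi_repr.
Qed.

Lemma tlift_linear : linear tlift.
Proof.
move=> c x y; have [fP|fNP] := pselect (multilinear f).
  by rewrite -[x]tpi_repr -[y]tpi_repr -linearP !tlift_pi // linearP.
by rewrite /tlift asboolF // scaler0 addr0.
Qed.

HB.instance Definition _ := GRing.isLinear.Build k tpow W _ tlift tlift_linear.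

Lemma tlift_pure a : multilinear f -> tlift (pure a) = f a.
Proof. by move=> fP; rewrite tlift_pi // free_liftU. Qed.

End Lift.

Lemma tpow_ind (P : tpow -> Prop) :
  P 0 -> (forall c a t, P t -> P (c *: pure a + t)) -> forall t, P t.
Proof.
move=> P0 PD t; rewrite -[t]tpi_repr; set z := repr _.
rewrite [z]monalgE; elim: (msupp z : seq _) => [|a s IH].
  by rewrite big_nil linear0.
rewrite big_cons linearD /=; suff -> : << z@_a *g a >> = z@_a *: (<< a >> : F).
  by rewrite linearZ; apply: PD.
by apply/malgP => b; rewrite mcoeffZ !mcoeffU mulrnAr mulr1.
Qed.

Lemma tpow_ext (W : lmodType k) (g h : {linear tpow -> W}) :
  (forall a, g (pure a) = h (pure a)) -> g =1 h.
Proof.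
move=> gh; elim/tpow_ind => [|c a t IH]; first by rewrite !linear0.
by rewrite !linearP gh IH.
Qed.

Lemma tlift_ext (W : lmodType k) (f g : {ffun 'I_n -> V} -> W) :
  f =1 g -> tlift f =1 tlift g.
Proof. by move=> /funext ->. Qed.

Lemma tlift_comb (W : lmodType k) (f g h : {ffun 'I_n -> V} -> W) c t :
  multilinear f -> multilinear g -> (forall a, h a = c *: f a + g a) ->
  tlift h t = c *: tlift f t + tlift g t.
Proof.
move=> fP gP hE; have hP : multilinear h.
  by move=> a i d x y; rewrite !hE fP gP !scalerDr !scalerA mulrC addrACA.
elim/tpow_ind: t => [|d a t IH]; first by rewrite !linear0 addr0.
have L u : tlift u (d *: pure a + t) = d *: tlift u (pure a) + tlift u t :> W.
  exact: linearP.
by rewrite !L IH !tlift_pure // hE !scalerDr !scalerA mulrC addrACA.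
Qed.

End TensorPower.

Arguments pure {k V n} a.

Section Operations.
Variables (k : comNzRingType) (V : lmodType k).
Local Notation T := (tpow V).

Definition castT m n (e : m = n) (t : T m) : T n := ecast i (T i) e t.

Definition tens1 (x : V) : T 1 := pure [ffun=> x].

Definition ffcat m n (a : {ffun 'I_m -> V}) (b : {ffun 'I_n -> V}) :
    {ffun 'I_(m + n) -> V} :=
  [ffun i => match split i with inl j => a j | inr j => b j end].

Lemma ffcat_updl m n (a : {ffun 'I_m -> V}) (b : {ffun 'I_n -> V}) i x :
  ffcat (upd a i x) b = upd (ffcat a b) (lshift n i) x.
Proof.
apply/ffunP => j; rewrite !ffunE; case: split_ordP => l ->.
  by rewrite ffunE eq_lshift.
by rewrite eq_rlshift.
Qed.

Lemma ffcat_updr m n (a : {ffun 'I_m -> V}) (b : {ffun 'I_n -> V}) i x :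
  ffcat a (upd b i x) = upd (ffcat a b) (rshift m i) x.
Proof.
apply/ffunP => j; rewrite !ffunE; case: split_ordP => l ->.
  by rewrite eq_lrshift.
by rewrite ffunE eq_rshift.
Qed.

Definition tmul m n (s : T m) (t : T n) : T (m + n) :=
  tlift (fun a => tlift (fun b => pure (ffcat a b)) t) s.

Lemma ffcat_multilinear m n (a : {ffun 'I_m -> V}) :
  multilinear (fun b : {ffun 'I_n -> V} => pure (ffcat a b)).
Proof. by move=> b i c x y; rewrite !ffcat_updr pure_multilinear. Qed.

Lemma tmul_multilinear m n (t : T n) :
  multilinear (fun a : {ffun 'I_m -> V} => tlift (fun b => pure (ffcat a b)) t).
Proof.
move=> a i c x y; apply: tlift_comb; try exact: ffcat_multilinear.
by move=> b; rewrite !ffcat_updl pure_multilinear.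
Qed.

Lemma tmul_pure m n (a : {ffun 'I_m -> V}) (b : {ffun 'I_n -> V}) :
  tmul (pure a) (pure b) = pure (ffcat a b).
Proof.
rewrite /tmul tlift_pure; last exact: tmul_multilinear.
by rewrite tlift_pure //; exact: ffcat_multilinear.
Qed.

Lemma tmul_linearl m n (t : T n) : linear (fun s : T m => tmul s t).
Proof. by move=> c x y; rewrite /tmul linearP. Qed.

Lemma tmul_linearr m n (s : T m) : linear (fun t : T n => tmul s t).
Proof.
move=> c x y; apply: tlift_comb => [||a]; try exact: tmul_multilinear.
exact: linearP.
Qed.

(* b (x)_rho t, for rho <= n (inord is junk beyond that): b becomes the factor
   of index rho, counting from 0. *)
Definition tinsert n (rho : nat) (b : V) (t : T n) : T n.+1 :=
  tlift (fun a => pure [ffun i => oapp a b (unlift (inord rho) i)]) t.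

Lemma tinsert_multilinear n rho b : multilinear (fun a : {ffun 'I_n -> V} =>
  pure [ffun i => oapp a b (unlift (inord rho) i)]).
Proof.
move=> a i c x y; set r : 'I_n.+1 := inord rho.
have E z : [ffun l => oapp (upd a i z) b (unlift r l)] =
    upd [ffun l => oapp a b (unlift r l)] (lift r i) z.
  apply/ffunP => l; rewrite !ffunE; case: unliftP => [j ->|->] /=.
    by rewrite ffunE (inj_eq lift_inj).
  by rewrite (negPf (neq_lift _ _)).
by rewrite !E pure_multilinear.
Qed.

Lemma tinsert_pure n rho b (a : {ffun 'I_n -> V}) :
  tinsert rho b (pure a) = pure [ffun i => oapp a b (unlift (inord rho) i)].
Proof. by rewrite /tinsert tlift_pure //; exact: tinsert_multilinear. Qed.

(* sigma moves the block k to position sigma k, so position j receives the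
   block sigma^-1 j. *)
Definition block_permute (S : Type) l (ms : l.-tuple nat) (sigma : 'S_l)
    (w : seq S) : seq S :=
  flatten [seq nth [::] (reshape ms w) ((sigma^-1)%g j) | j : 'I_l]
    ++ drop (sumn ms) w.

Lemma block_permute_map (S S' : Type) (h : S -> S') l (ms : l.-tuple nat)
    (sigma : 'S_l) w :
  block_permute ms sigma (map h w) = map h (block_permute ms sigma w).
Proof.
rewrite /block_permute map_cat map_drop map_flatten -map_comp.
congr (flatten _ ++ _); apply: eq_map => j /=.
have sz (u : seq S) (v : seq nat) : size (reshape v u) = size v.
  by elim: v u => //= m v IH u; rewrite IH.
have -> : reshape ms (map h w) = map (map h) (reshape ms w).
  elim: (tval ms) w => //= m v IH w.
  by rewrite map_take -map_drop IH.
by rewrite (nth_map [::]) // sz size_tuple.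
Qed.

Lemma perm_block_permute (S : eqType) l (ms : l.-tuple nat) (sigma : 'S_l)
    (w : seq S) : perm_eq (block_permute ms sigma w) w.
Proof.
have sz (u : seq S) (v : seq nat) : size (reshape v u) = size v.
  by elim: v u => //= m v IH u; rewrite IH.
have fl (u : seq S) (v : seq nat) : flatten (reshape v u) = take (sumn v) u.
  elim: v u => [|m v IH] u /=; first by rewrite take0.
  by rewrite IH takeD.
rewrite -{2}[w](cat_take_drop (sumn ms)) perm_cat2r -fl.
apply: perm_flatten.
rewrite -[X in perm_eq _ X](mkseq_nth [::]) sz size_tuple /mkseq -val_enum_ord.
rewrite -map_comp [X in perm_eq X](_ : _ =
  map (fun i : 'I_l => nth [::] (reshape ms w) i)
    (map (sigma^-1)%g (enum 'I_l))); last by rewrite -map_comp.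
apply: perm_map; apply: uniq_perm; rewrite ?enum_uniq //.
  by rewrite map_inj_uniq ?enum_uniq //; exact: perm_inj.
move=> i; rewrite mem_enum; apply/mapP; exists (sigma i).
  by rewrite mem_enum.
by rewrite permK.
Qed.

(* tau_sigma^{ms} acts on the first sumn ms factors of a tensor of degree n,
   in consecutive blocks of lengths ms, and leaves the other factors in place. *)
Definition tau n l (ms : l.-tuple nat) (sigma : 'S_l) (t : T n) : T n :=
  tlift (fun a =>
    pure [ffun i : 'I_n => nth (a i) (block_permute ms sigma (codom a)) i]) t.

Lemma tau_reindex n l (ms : l.-tuple nat) (sigma : 'S_l) :
  exists p : 'S_n, forall a : {ffun 'I_n -> V},
    [ffun i : 'I_n => nth (a i) (block_permute ms sigma (codom a)) i]
      = [ffun i => a (p i)].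
Proof.
pose w := block_permute ms sigma (enum 'I_n).
have wP : perm_eq w (enum 'I_n) by exact: perm_block_permute.
have wn : size w = n by rewrite (perm_size wP) size_enum_ord.
have p_inj : injective (fun i : 'I_n => nth i w i).
  move=> i j /eqP; rewrite (set_nth_default i j) ?wn // nth_uniq ?wn //.
    by move=> /eqP/val_inj.
  by rewrite (perm_uniq wP) enum_uniq.
exists (perm p_inj) => a; apply/ffunP => i; rewrite !ffunE permE.
by rewrite codomE block_permute_map (nth_map i) // wn.
Qed.

Lemma tau_multilinear n l (ms : l.-tuple nat) (sigma : 'S_l) :
  multilinear (fun a : {ffun 'I_n -> V} => pure
    [ffun i : 'I_n => nth (a i) (block_permute ms sigma (codom a)) i]).
Proof.
have [p pE] := tau_reindex n ms sigma; move=> a i c x y; rewrite !pE.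
have E z : [ffun l => upd a i z (p l)] =
    upd [ffun l => a (p l)] ((p^-1)%g i) z.
  apply/ffunP => j; rewrite !ffunE.
  by rewrite -[j == _](inj_eq (@perm_inj _ p)) permKV.
by rewrite !E pure_multilinear.
Qed.

Lemma tau_pure n l (ms : l.-tuple nat) (sigma : 'S_l) (a : {ffun 'I_n -> V}) :
  tau ms sigma (pure a) =
    pure [ffun i : 'I_n => nth (a i) (block_permute ms sigma (codom a)) i].
Proof. by rewrite /tau tlift_pure //; exact: tau_multilinear. Qed.

Definition tderive (D : V -> V) n (t : T n) : T n :=
  tlift (fun a => \sum_i pure (upd a i (D (a i)))) t.

Lemma tderive_multilinear (D : V -> V) n : linear D ->
  multilinear (fun a : {ffun 'I_n -> V} => \sum_i pure (upd a i (D (a i)))).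
Proof.
move=> DP a i c x y; rewrite scaler_sumr -big_split /=; apply: eq_bigr => j _.
have [->|ji] := eqVneq j i.
  have E z w : upd (upd a i z) i w = upd a i w.
    by apply/ffunP => l; rewrite !ffunE; case: eqP.
  by rewrite !E !ffunE eqxx DP pure_multilinear.
have E z w : upd (upd a i z) j w = upd (upd a j w) i z.
  apply/ffunP => l; rewrite !ffunE; have [->|//] := eqVneq l j.
  by rewrite (negPf ji).
by rewrite !E !ffunE (negPf ji) pure_multilinear.
Qed.

Lemma tderive_pure (D : V -> V) n (a : {ffun 'I_n -> V}) : linear D ->
  tderive D (pure a) = \sum_i pure (upd a i (D (a i))).
Proof. by move=> DP; rewrite /tderive tlift_pure //; exact: tderive_multilinear. Qed.

End Operations.

Notation "x ⊗ y" := (tmul x y) (at level 40, left associativity) : ring_scope.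

Section AlgebraOperations.
Variables (k : comNzRingType) (A : algType k).
Local Notation T := (tpow A).

(* m_{u,v}, for u < v <= n: the factors are counted from 0, so that
   tmerge u v is m_{u+1,v+1} in 1-based numbering. *)
Definition tmerge n (u v : nat) (t : T n.+1) : T n :=
  tlift (fun a => pure [ffun i : 'I_n =>
    if lift (inord u) i == inord v then a (inord u) * a (inord v)
    else a (lift (inord u) i)]) t.

Lemma tmerge_multilinear n (u v : nat) : (u < v)%N -> (v <= n)%N ->
  multilinear (fun a : {ffun 'I_n.+1 -> A} => pure [ffun i : 'I_n =>
    if lift (inord u) i == inord v then a (inord u) * a (inord v)
    else a (lift (inord u) i)]).
Proof.
move=> uv vn; have : inord u != inord v :> 'I_n.+1.
  rewrite -val_eqE /= !inordK ?ltnS // ?(ltnW (leq_trans uv vn)) //.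
  by rewrite neq_ltn uv.
clear uv vn; move: (inord u) (inord v) => {}u {}v uv a i c x y.
have [j jv] : exists j, v = lift u j.
  by case: (unliftP u v) uv => [j -> _|->]; [exists j | rewrite eqxx].
rewrite {v}jv in uv *.
pose g (b : {ffun 'I_n.+1 -> A}) := [ffun l => if lift u l == lift u j
  then b u * b (lift u j) else b (lift u l)].
suff [q [h [hP E]]] : exists q (h : A -> A),
    (forall d z w, h (d *: z + w) = d *: h z + h w) /\
    forall z, g (upd a i z) = upd (g a) q (h z).
  by rewrite -!/(g _) !E hP pure_multilinear.
case: (unliftP u i) => [i' ->|->].
- have [->|ij] := eqVneq i' j.
    exists j, (fun z => a u * z); split=> [d z w|z].
      by rewrite mulrDr scalerAr.
    apply/ffunP => l; rewrite !ffunE !(inj_eq lift_inj) (negPf (neq_lift _ _)).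
    by rewrite eqxx; case: eqVneq.
  exists i', id; split=> // z.
  apply/ffunP => l; rewrite !ffunE !(inj_eq lift_inj) (negPf (neq_lift _ _)).
  have [->|lj] := eqVneq l j; last by [].
  by rewrite eq_sym (negPf ij).
- exists j, (fun z => z * a (lift u j)); split=> [d z w|z].
    by rewrite mulrDl scalerAl.
  apply/ffunP => l; rewrite !ffunE !(inj_eq lift_inj) eqxx.
  rewrite ![lift _ _ == u]eq_sym !(negPf (neq_lift _ _)).
  by case: eqVneq.
Qed.

Lemma tmerge_pure n (u v : nat) (a : {ffun 'I_n.+1 -> A}) :
  (u < v)%N -> (v <= n)%N -> tmerge u v (pure a) = pure [ffun i : 'I_n =>
    if lift (inord u) i == inord v then a (inord u) * a (inord v)
    else a (lift (inord u) i)].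
Proof.
by move=> uv vn; rewrite /tmerge tlift_pure //; exact: tmerge_multilinear.
Qed.

Definition tmult (t : T 2) : A := tlift (fun a => a ord0 * a ord_max) t.

Lemma tmult_multilinear :
  multilinear (fun a : {ffun 'I_2 -> A} => a ord0 * a ord_max).
Proof.
move=> a i c x y; rewrite !ffunE.
have [<-|i0] := eqVneq ord0 i.
  by rewrite -val_eqE /= mulrDl scalerAl.
have -> : i = ord_max.
  by case: i i0 => [[|[|//]] ip] //= _; apply: val_inj.
by rewrite eqxx mulrDr scalerAr.
Qed.

Lemma tmult_pure a : tmult (pure a) = a ord0 * a ord_max.
Proof. by rewrite /tmult tlift_pure //; exact: tmult_multilinear. Qed.

Definition is_derivation (D : A -> A) : Prop :=
  linear D /\ forall a b, D (a * b) = D a * b + a * D b.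

End AlgebraOperations.

Definition S2_12 : 'S_2 := tperm ord0 ord_max.
(* ordS is the successor modulo 3: blocks 1, 2, 3 go to positions 2, 3, 1. *)
Definition S3_123 : 'S_3 := perm (@ordS_inj 3).
Definition S3_132 : 'S_3 := (S3_123^-1)%g.
Definition S3_23 : 'S_3 := tperm (inord 1) (inord 2).

Lemma deg_srt r s t : (s + (t + r) = r + (s + t))%N.
Proof. by rewrite addnA addnC. Qed.
Lemma deg_trs r s t : (t + (r + s) = r + (s + t))%N.
Proof. by rewrite addnC addnA. Qed.
Lemma deg_tr_s r s t : (t + r + s = r + s + t)%N.
Proof. by rewrite -addnA addnC. Qed.
Lemma deg_r_ts r s t : (r + (t + s) = r + s + t)%N.
Proof. by rewrite [(t + s)%N]addnC addnA. Qed.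

(* The id-adapted double transposed Poisson structures on A. The components
   br r s with r = 0 or s = 0 are junk: the axioms only concern positive
   degrees. The casts castT identify tensor powers of equal degrees. *)
Record idDTPA (k : comNzRingType) (A : algType k) := IdDTPA {
  br :> forall r s : nat, {bilinear tpow A r -> tpow A s -> tpow A (r + s)};
  br_skew : forall r s (alpha : tpow A r) (beta : tpow A s),
    (0 < r)%N -> (0 < s)%N ->
    br r s alpha beta
      = - castT (addnC s r) (tau [tuple s; r] S2_12 (br s r beta alpha));
  br_jacobi : forall r s t
    (alpha : tpow A r) (beta : tpow A s) (gamma : tpow A t),
    (0 < r)%N -> (0 < s)%N -> (0 < t)%N ->
    br r (s + t) alpha (br s t beta gamma)
    + castT (deg_srt r s t)
        (tau [tuple s; t; r] S3_123 (br s (t + r) beta (br t r gamma alpha)))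
    + castT (deg_trs r s t)
        (tau [tuple t; r; s] S3_132 (br t (r + s) gamma (br r s alpha beta)))
    = 0;
  br_leibnizl : forall r s t
    (alpha : tpow A r) (beta : tpow A s) (gamma : tpow A t),
    (0 < r)%N -> (0 < s)%N -> (0 < t)%N ->
    2%:R *: (gamma ⊗ br r s alpha beta)
    = castT (esym (addnA t r s)) (br (t + r) s (gamma ⊗ alpha) beta)
      + castT (addnCA r t s)
          (tau [tuple r; t] S2_12 (br r (t + s) alpha (gamma ⊗ beta)));
  br_leibnizr : forall r s t
    (alpha : tpow A r) (beta : tpow A s) (gamma : tpow A t),
    (0 < r)%N -> (0 < s)%N -> (0 < t)%N ->
    2%:R *: (br r s alpha beta ⊗ gamma)
    = castT (deg_tr_s r s t)
        (tau [tuple t; r; s] S3_132 (br (t + r) s (gamma ⊗ alpha) beta))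
      + castT (deg_r_ts r s t)
          (tau [tuple r; t; s] S3_23 (br r (t + s) alpha (gamma ⊗ beta)));
  br_unit : forall s (beta : tpow A s), (0 < s)%N ->
    exists beta' : tpow A s, br 1 s (tens1 1) beta = tens1 1 ⊗ beta';
  br_insertl : forall r s (alpha : tpow A r) (beta : tpow A s) rho,
    (0 < r)%N -> (0 < s)%N -> (rho <= r)%N ->
    br r.+1 s (tinsert rho 1 alpha) beta = tinsert rho 1 (br r s alpha beta);
  br_insertr : forall r s (alpha : tpow A r) (beta : tpow A s) vsigma,
    (0 < r)%N -> (0 < s)%N -> (vsigma <= s)%N ->
    br r s.+1 alpha (tinsert vsigma 1 beta)
    = castT (esym (addnS r s)) (tinsert (r + vsigma) 1 (br r s alpha beta));
  br_mergel : forall r s (alpha : tpow A r.+1) (beta : tpow A s) rho,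
    (0 < s)%N -> (rho < r)%N ->
    br r s (tmerge rho rho.+1 alpha) beta
    = tmerge rho rho.+1 (br r.+1 s alpha beta);
  br_merger : forall r s (alpha : tpow A r) (beta : tpow A s.+1) vsigma,
    (0 < r)%N -> (vsigma < s)%N ->
    br r s alpha (tmerge vsigma vsigma.+1 beta)
    = tmerge (r + vsigma) (r + vsigma).+1
        (castT (addnS r s) (br r s.+1 alpha beta));
  br_taur : forall r s (alpha : tpow A r) (beta : tpow A s)
    l (ms : l.-tuple nat) (sigma : 'S_l),
    (0 < r)%N -> (0 < s)%N -> all (leq 1) ms -> sumn ms = s ->
    br r s alpha (tau ms sigma beta)
    = tau [tuple of r :: ms] (lift_perm ord0 ord0 sigma) (br r s alpha beta);
  br_taul : forall r s (alpha : tpow A r) (beta : tpow A s)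
    l (ms : l.-tuple nat) (sigma : 'S_l),
    (0 < r)%N -> (0 < s)%N -> all (leq 1) ms -> sumn ms = s ->
    br s r (tau ms sigma beta) alpha = tau ms sigma (br s r beta alpha)
}.

Definition brD (k : comNzRingType) (A : algType k) (P : idDTPA A) (a : A) : A :=
  tmult (P 1%N 1%N (tens1 1) (tens1 a)).

(* Main.v *)
From HB Require Import structures.
Require Import Defs.
From mathcomp Require Import all_fingroup all_boot all_order all_algebra.

Set Implicit Arguments.
Unset Strict Implicit.
Unset Printing Implicit Defensive.

Import GRing.Theory.
Local Open Scope ring_scope.

(** Write [[-,-]] for the bracket. The unit axiom says that [[1, t]] is 1 ⊗ D t
    for some D t, a tensor of the same degree as t; D is linear, is [brD] in
    degree one, and commutes with permutations of factors because the bracket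
    does.

    In the left Leibniz rule put 1 for the argument alpha. All terms then carry
    the factor 1 at the same place, just after the degree of s: the left side
    is 2 s ⊗ 1 ⊗ D t, the first bracket on the right is [[s ⊗ 1, t]], which is
    [[s, t]] with a 1 inserted, and the second is a permutation of
    1 ⊗ D (s ⊗ t). Inserting a 1 is injective, since multiplying it by the
    factor that follows removes it again, so that ([br_addD])

      [[s, t]] + D (s ⊗ t) = 2 s ⊗ D t.

    Exchange s and t, swap the two blocks, and compare with the skew symmetry
    of the bracket: the sum of the two identities is
    2 D (s ⊗ t) = 2 (D s ⊗ t + s ⊗ D t). As 2 is invertible, D satisfies the
    Leibniz rule for ⊗ ([brDn_tmul]), and substituting it above gives the
    formula for the bracket ([brE]). Induction on the degree identifies D with
    the extension of [brD] to tensor powers ([brDn_tderive]). Finally D commutes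
    with the multiplication of adjacent factors, so the Leibniz rule for x ⊗ y
    becomes the one for the product x * y ([brD_derivation]). *)

(** * Linear maps given as plain functions *)

Lemma linear_funD (k : comNzRingType) (U W : lmodType k) (g : U -> W) x y :
  linear g -> g (x + y) = g x + g y.
Proof. by move=> gP; have := gP 1 x y; rewrite !scale1r. Qed.

Lemma linear_fun0 (k : comNzRingType) (U W : lmodType k) (g : U -> W) :
  linear g -> g 0 = 0.
Proof. by move=> gP; have := gP (-1) 0 0; rewrite scaler0 addr0 scaleN1r addNr. Qed.

Lemma linear_funZ (k : comNzRingType) (U W : lmodType k) (g : U -> W) c x :
  linear g -> g (c *: x) = c *: g x.
Proof.
by move=> gP; have := gP c x 0; rewrite (linear_fun0 gP) !addr0.
Qed.

Lemma linear_fun_sum (k : comNzRingType) (U W : lmodType k) (g : U -> W)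
    (I : finType) (F : I -> U) :
  linear g -> g (\sum_i F i) = \sum_i g (F i).
Proof.
move=> gP; pose gL := GRing.isLinear.Build k U W _ g gP.
pose g' : {linear U -> W} := HB.pack g gL.
exact: (linear_sum g').
Qed.

(** * Tensor powers and the words of pure tensors *)

Section TensorWords.
Variables (k : comNzRingType) (V : lmodType k).
Local Notation T := (tpow V).

Lemma tpow_linear_eq n (W : lmodType k) (g h : T n -> W) :
  linear g -> linear h -> (forall a, g (pure a) = h (pure a)) -> g =1 h.
Proof.
move=> gP hP gh; elim/tpow_ind => [|c a t IH]; last by rewrite gP hP gh IH.
by rewrite !linear_fun0.
Qed.

Lemma tpow_bilinear_eq m n (W : lmodType k) (g h : T m -> T n -> W) :
  (forall t, linear (g^~ t)) -> (forall s, linear (g s)) ->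
  (forall t, linear (h^~ t)) -> (forall s, linear (h s)) ->
  (forall a b, g (pure a) (pure b) = h (pure a) (pure b)) ->
  forall s t, g s t = h s t.
Proof.
move=> gl gr hl hr gh s t; move: s; apply: tpow_linear_eq => // a.
by move: t; apply: tpow_linear_eq.
Qed.

Lemma castT_id n (e : n = n) (t : T n) : castT e t = t.
Proof. by rewrite (eq_irrelevance e erefl). Qed.

Lemma castT_trans m n p (e : m = n) (e' : n = p) (t : T m) :
  castT e' (castT e t) = castT (etrans e e') t.
Proof. by case: _ / e'. Qed.

Lemma castT_linear m n (e : m = n) : linear (castT e : T m -> T n).
Proof. by case: _ / e. Qed.

Lemma tau_linear n l (ms : l.-tuple nat) (sigma : 'S_l) :
  linear (@tau k V n l ms sigma).
Proof. by move=> c x y; rewrite /tau linearP. Qed.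

Lemma tinsert_linear n rho x : linear (@tinsert k V n rho x).
Proof. by move=> c s t; rewrite /tinsert linearP. Qed.

(** Pure tensors of provably equal but distinct degrees live in different types;
    their words [codom a] live in one type of sequences. All the identities below
    between pure tensors are therefore checked on words. *)
Lemma size_codom_ord n (a : {ffun 'I_n -> V}) : size (codom a) = n.
Proof. by rewrite size_codom card_ord. Qed.

Lemma nth_codom_ord n (a : {ffun 'I_n -> V}) x (i : 'I_n) :
  nth x (codom a) i = a i.
Proof. by rewrite codomE (nth_map i) ?size_enum_ord // nth_ord_enum. Qed.

Lemma codom_ord_eq n (a : {ffun 'I_n -> V}) (s : seq V) :
  size s = n -> (forall i : 'I_n, a i = nth 0 s i) -> codom a = s.
Proof.
move=> sn aE; apply: (@eq_from_nth _ 0); rewrite size_codom_ord // => i ilt.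
exact: etrans (nth_codom_ord a 0 (Ordinal ilt)) (aE _).
Qed.

(** This carries an identity of words back to tensors; without a cast it is used
    with [castT erefl]. *)
Lemma castT_pure m n (e : m = n) (a : {ffun 'I_m -> V}) (b : {ffun 'I_n -> V}) :
  codom a = codom b -> castT e (pure a) = pure b.
Proof.
case: _ / e b => b ab; congr (pure _); apply/ffunP => i.
by rewrite -(nth_codom_ord a 0) ab nth_codom_ord.
Qed.

Lemma codom_tens1 x : codom ([ffun=> x] : {ffun 'I_1 -> V}) = [:: x].
Proof. by apply: codom_ord_eq => // i; rewrite ffunE ord1. Qed.

Lemma codom_ffcat m n (a : {ffun 'I_m -> V}) (b : {ffun 'I_n -> V}) :
  codom (ffcat a b) = codom a ++ codom b.
Proof.
apply: codom_ord_eq => [|i]; first by rewrite size_cat !size_codom_ord.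
rewrite ffunE nth_cat size_codom_ord.
case: split_ordP => j -> /=; first by rewrite nth_codom_ord.
by rewrite addKn nth_codom_ord.
Qed.

(** The degree is n.+1 here rather than the convertible 1 + n, so that the lemma
    rewrites in tensors of an explicit degree. *)
Lemma codom_ffcat_cons n x (a : {ffun 'I_n -> V}) :
  codom (@ffcat k V 1 n [ffun=> x] a : {ffun 'I_n.+1 -> V}) = x :: codom a.
Proof. by have := @codom_ffcat 1 n [ffun=> x] a; rewrite codom_tens1. Qed.

Lemma codom_tau n l (ms : l.-tuple nat) (sigma : 'S_l) (a : {ffun 'I_n -> V}) :
  codom [ffun i : 'I_n => nth (a i) (block_permute ms sigma (codom a)) i]
  = block_permute ms sigma (codom a).
Proof.
have sz : size (block_permute ms sigma (codom a)) = n.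
  by rewrite (perm_size (perm_block_permute _ _ _)) size_codom_ord.
apply: codom_ord_eq => // i.
by rewrite ffunE; apply: set_nth_default; rewrite sz.
Qed.

Lemma codom_tinsert n rho x (a : {ffun 'I_n -> V}) : (rho <= n)%N ->
  codom [ffun i => oapp a x (unlift (inord rho) i)]
  = take rho (codom a) ++ x :: drop rho (codom a).
Proof.
move=> rn; apply: codom_ord_eq => [|i].
  by rewrite size_cat /= size_drop size_takel size_codom_ord // addnS subnKC.
rewrite ffunE nth_cat size_takel ?size_codom_ord //.
have rv : (inord rho : 'I_n.+1) = rho :> nat by rewrite inordK.
case: unliftP => [j|] -> /=; last by rewrite rv ltnn subnn.
rewrite /bump rv; case: (leqP rho j) => jr; rewrite ?add1n ?add0n.
  by rewrite ltnNge leqW //= subSn //= nth_drop subnKC // nth_codom_ord.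
by rewrite jr nth_take // nth_codom_ord.
Qed.

Lemma block_permute_swap m n (w : seq V) :
  block_permute [tuple m; n] S2_12 w
  = take n (drop m w) ++ take m w ++ drop (m + n) w.
Proof.
rewrite /block_permute /image_mem !enum_ordSl /= enum_ord0 /= addn0 cats0.
have -> : lift ord0 ord0 = ord_max :> 'I_2 by apply: val_inj.
by rewrite /S2_12 tpermV tpermL tpermR /= -catA.
Qed.

Lemma block_permute_lift m l (ms : l.-tuple nat) (sigma : 'S_l) (w : seq V) :
  block_permute [tuple of m :: ms] (lift_perm ord0 ord0 sigma) w
  = take m w ++ block_permute ms sigma (drop m w).
Proof.
rewrite /block_permute /image_mem enum_ordSl /= lift_permV lift_perm_id /=.
rewrite drop_drop addnC -catA; congr (_ ++ (flatten _ ++ _)).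
by rewrite -map_comp; apply: eq_map => j /=; rewrite lift_perm_lift.
Qed.

Lemma tau_swap_tmul m n (s : T m) (t : T n) :
  tau [tuple m; n] S2_12 (s ⊗ t) = castT (addnC n m) (t ⊗ s).
Proof.
apply: (@tpow_bilinear_eq _ _ _ (fun s t => tau [tuple m; n] S2_12 (s ⊗ t))
  (fun s t => castT (addnC n m) (t ⊗ s))) s t => [t|s|t|s|a b] /=.
- by move=> c x y; rewrite tmul_linearl tau_linear.
- by move=> c x y; rewrite tmul_linearr tau_linear.
- by move=> c x y; rewrite tmul_linearr castT_linear.
- by move=> c x y; rewrite tmul_linearl castT_linear.
rewrite !tmul_pure tau_pure; symmetry; apply: castT_pure.
rewrite codom_tau !codom_ffcat block_permute_swap.
rewrite drop_size_cat ?take_size_cat ?size_codom_ord //.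
rewrite take_oversize ?drop_oversize ?cats0 //.
  by rewrite size_cat !size_codom_ord.
by rewrite size_codom_ord.
Qed.

Definition swap_blocks m n (t : T (m + n)) : T (n + m) :=
  castT (addnC m n) (tau [tuple m; n] S2_12 t).

Lemma swap_blocks_linear m n : linear (@swap_blocks m n).
Proof. by move=> c x y; rewrite /swap_blocks tau_linear castT_linear. Qed.

Lemma swap_blocks_tmul m n (s : T m) (t : T n) : swap_blocks (s ⊗ t) = t ⊗ s.
Proof. by rewrite /swap_blocks tau_swap_tmul castT_trans castT_id. Qed.

Lemma tau_lift_tmul m n l (ms : l.-tuple nat) (sigma : 'S_l) (s : T m) (t : T n) :
  tau [tuple of m :: ms] (lift_perm ord0 ord0 sigma) (s ⊗ t)
  = s ⊗ tau ms sigma t.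
Proof.
apply: (@tpow_bilinear_eq _ _ _
  (fun s t => tau [tuple of m :: ms] (lift_perm ord0 ord0 sigma) (s ⊗ t))
  (fun s t => s ⊗ tau ms sigma t)) s t => [t|s|t|s|a b] /=.
- by move=> c x y; rewrite tmul_linearl tau_linear.
- by move=> c x y; rewrite tmul_linearr tau_linear.
- by move=> c x y; rewrite tmul_linearl.
- by move=> c x y; rewrite tau_linear tmul_linearr.
rewrite !(tmul_pure, tau_pure) -[LHS](castT_id erefl); apply: castT_pure.
rewrite codom_tau !codom_ffcat codom_tau block_permute_lift.
by rewrite drop_size_cat ?take_size_cat ?size_codom_ord.
Qed.

Lemma tens1_tmul n x (t : T n) : tens1 x ⊗ t = tinsert 0 x t.
Proof.
move: t; apply: tpow_linear_eq => [||a].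
- exact: tmul_linearr.
- exact: tinsert_linear.
rewrite tmul_pure tinsert_pure -[LHS](castT_id erefl); apply: castT_pure.
by rewrite codom_ffcat codom_tens1 codom_tinsert // take0 drop0.
Qed.

Lemma tmul_tens1 n x (t : T n) :
  castT (addn1 n) (t ⊗ tens1 x) = tinsert n x t.
Proof.
move: t; apply: tpow_linear_eq => [c y z||a].
- by rewrite tmul_linearl castT_linear.
- exact: tinsert_linear.
rewrite tmul_pure tinsert_pure; apply: castT_pure.
rewrite codom_ffcat codom_tens1 codom_tinsert //.
by rewrite take_oversize ?drop_oversize // size_codom_ord.
Qed.

Lemma tmul_tens1_tmul m n x (s : T m) (t : T n)
    (e : (m + (1 + n))%N = (m + n).+1) :
  castT e (s ⊗ (tens1 x ⊗ t)) = tinsert m x (s ⊗ t).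
Proof.
apply: (@tpow_bilinear_eq _ _ _
  (fun s t => castT e (s ⊗ (tens1 x ⊗ t)))
  (fun s t => tinsert m x (s ⊗ t))) s t => [t|s|t|s|a b] /=.
- by move=> c y z; rewrite tmul_linearl castT_linear.
- by move=> c y z; rewrite !tmul_linearr castT_linear.
- by move=> c y z; rewrite tmul_linearl tinsert_linear.
- by move=> c y z; rewrite !tmul_linearr tinsert_linear.
rewrite !tmul_pure tinsert_pure; apply: castT_pure.
rewrite codom_tinsert ?leq_addr // !codom_ffcat codom_tens1.
by rewrite drop_size_cat ?take_size_cat ?size_codom_ord.
Qed.

Lemma tau_swap_tens1 m n x (t : T n) : (m <= n)%N ->
  tau [tuple 1%N; m] S2_12 (tens1 x ⊗ t) = tinsert m x t.
Proof.
move=> mn; move: t; apply: tpow_linear_eq => [c y z||a].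
- by rewrite tmul_linearr tau_linear.
- exact: tinsert_linear.
rewrite tmul_pure tau_pure tinsert_pure -[LHS](castT_id erefl).
apply: castT_pure; rewrite codom_tau codom_tinsert // codom_ffcat codom_tens1.
by rewrite block_permute_swap /= drop0 take0.
Qed.

(** Not only the pure tensors but all tensors of degree one come from [tens1]:
    a linear combination can be collected in the single factor. *)
Lemma tpow1_ind (Q : T 1 -> Prop) : (forall x, Q (tens1 x)) -> forall t, Q t.
Proof.
move=> Qx t; suff [x ->] : exists x, t = tens1 x by [].
elim/tpow_ind: t => [|c a t [y ->]].
  (* the zero tensor is the pure tensor of 0 *)
  exists 0; have := @pure_multilinear k V 1 0 ord0 (-1) 0 0.
  rewrite scaler0 addr0 scaleN1r addNr => <-; congr (pure _).
  by apply/ffunP => i; rewrite !ffunE ord1 eqxx.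
exists (c *: a ord0 + y).
have E z : pure (upd a ord0 z) = tens1 z.
  by congr (pure _); apply/ffunP => i; rewrite !ffunE (ord1 i) eqxx.
have aE : tens1 (a ord0) = pure a.
  by congr (pure _); apply/ffunP => i; rewrite !ffunE (ord1 i).
by rewrite -aE -!E (pure_multilinear a ord0 c (a ord0) y).
Qed.

Lemma pure_tens1 (a : {ffun 'I_1 -> V}) : pure a = tens1 (a ord0).
Proof. by congr (pure _); apply/ffunP => i; rewrite ffunE ord1. Qed.

Lemma pureS n (a : {ffun 'I_n.+1 -> V}) :
  pure a = tens1 (a ord0) ⊗ pure [ffun i => a (lift ord0 i)].
Proof.
rewrite tmul_pure; congr (pure _); apply/ffunP => i.
rewrite [RHS]ffunE; case: split_ordP => j ->; rewrite ffunE ?ord1.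
  by congr (a _); apply: val_inj.
by congr (a _); apply: val_inj.
Qed.

Lemma tderive_tmul (D : V -> V) m n (s : T m) (t : T n) : linear D ->
  tderive D (s ⊗ t) = tderive D s ⊗ t + s ⊗ tderive D t.
Proof.
move=> DP.
have dP p : linear (@tderive k V D p) by move=> c x y; rewrite /tderive linearP.
apply: (@tpow_bilinear_eq _ _ _ (fun s t => tderive D (s ⊗ t))
  (fun s t => tderive D s ⊗ t + s ⊗ tderive D t)) s t => [t|s|t|s|a b] /=.
- by move=> c x y; rewrite tmul_linearl dP.
- by move=> c x y; rewrite tmul_linearr dP.
- by move=> c x y; rewrite dP !tmul_linearl scalerDr addrACA.
- by move=> c x y; rewrite dP !tmul_linearr scalerDr addrACA.
rewrite tmul_pure !tderive_pure // big_split_ord /=.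
rewrite (linear_fun_sum _ (tmul_linearl (pure b))).
rewrite (linear_fun_sum _ (tmul_linearr (pure a))).
congr (_ + _); apply: eq_bigr => i _; rewrite tmul_pure.
  rewrite ffcat_updl; congr (pure (upd _ _ (D _))).
  by rewrite ffunE (unsplitK (inl i)).
rewrite ffcat_updr; congr (pure (upd _ _ (D _))).
by rewrite ffunE (unsplitK (inr i)).
Qed.

End TensorWords.

(** * Multiplying adjacent factors *)

Section Merge.
Variables (k : comNzRingType) (A : algType k).
Local Notation T := (tpow A).

(** A unit inserted before an existing factor is absorbed by it. The bound on rho
    is what provides that factor. *)
Lemma tinsert1K n rho : (rho < n)%N ->
  cancel (@tinsert k A n rho 1) (@tmerge k A n rho rho.+1).
Proof.
move=> rn; apply: tpow_linear_eq => [c y z||a].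
- by rewrite tinsert_linear /tmerge linearP.
- by [].
rewrite tinsert_pure tmerge_pure //; congr (pure _); apply/ffunP => i.
have Er : inord rho.+1 = lift (inord rho) (Ordinal rn) :> 'I_n.+1.
  apply: val_inj; rewrite /= /bump !inordK ?leqnn ?add1n //; exact: leqW.
rewrite !ffunE Er (inj_eq lift_inj) unlift_none !liftK /= mul1r.
by case: eqVneq => // ->.
Qed.

Lemma tens1_tmulK n (t : T n) : (0 < n)%N -> tmerge 0 1 (tens1 1 ⊗ t) = t.
Proof. by move=> n0; rewrite (tens1_tmul 1 t); exact: tinsert1K. Qed.

Lemma codom_tmerge n u (a : {ffun 'I_n.+1 -> A}) : (u < n)%N ->
  codom [ffun i : 'I_n => if lift (inord u) i == inord u.+1
    then a (inord u) * a (inord u.+1) else a (lift (inord u) i)]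
  = take u (codom a)
    ++ nth 0 (codom a) u * nth 0 (codom a) u.+1 :: drop u.+2 (codom a).
Proof.
move=> un; have v0 : (inord u : 'I_n.+1) = u :> nat by rewrite inordK // ltnW.
have v1 : (inord u.+1 : 'I_n.+1) = u.+1 :> nat by rewrite inordK.
have sz : size (take u (codom a)) = u.
  by rewrite size_takel // size_codom_ord ltnW // ltnW.
apply: codom_ord_eq => [|i].
  by rewrite size_cat /= sz size_drop size_codom_ord subSS addnS -addSn subnKC.
rewrite ffunE nth_cat sz -!(nth_codom_ord a 0) -val_eqE /= !v0 v1 /bump.
case: (ltngtP i u) => [iu|ui|->].
- by rewrite add0n ltn_eqF ?leqW // nth_take.
- rewrite add1n eqSS gtn_eqF // -(subnSK ui) /= nth_drop.
  by rewrite 2!addSn -addnS subnSK // subnKC 1?ltnW.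
- by rewrite eqxx subnn.
Qed.

Lemma tmult_tens1 x y : tmult (tens1 x ⊗ tens1 y : T 2) = x * y.
Proof.
rewrite tmul_pure tmult_pure; set c := @ffcat _ _ 1 1 _ _.
by rewrite -!(nth_codom_ord c 0) /c !codom_ffcat !codom_tens1.
Qed.

Lemma tmerge_tens1 x y : tmerge 0 1 (tens1 x ⊗ tens1 y : T 2) = tens1 (x * y).
Proof.
rewrite tmul_pure tmerge_pure // -[LHS](castT_id erefl); apply: castT_pure.
by rewrite codom_tmerge // !codom_ffcat_cons !codom_tens1.
Qed.

Lemma tmerge_tens1_tens2 x y z :
  tmerge 1 2 (tens1 x ⊗ (tens1 y ⊗ tens1 z) : T 3) = tens1 x ⊗ tens1 (y * z).
Proof.
rewrite !tmul_pure tmerge_pure // -[LHS](castT_id erefl); apply: castT_pure.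
by rewrite codom_tmerge // !codom_ffcat_cons !codom_tens1.
Qed.

Lemma tmult_tmerge_tens1 y z :
  tmult (tmerge 1 2 (tens1 1 ⊗ (tens1 y ⊗ tens1 z) : T 3)) = y * z.
Proof. by rewrite tmerge_tens1_tens2 tmult_tens1 mul1r. Qed.

Lemma tens1_linear : linear (@tens1 k A).
Proof.
have E z : [ffun=> z] = upd [ffun=> 0] ord0 z :> {ffun 'I_1 -> A}.
  by apply/ffunP => i; rewrite !ffunE ord1 eqxx.
by move=> c x y; rewrite /tens1 (E (_ + _)) (E x) (E y) pure_multilinear.
Qed.

Lemma tmult_linear : linear (@tmult k A).
Proof. by move=> c x y; rewrite /tmult linearP. Qed.

Lemma tens1_inj : injective (@tens1 k A).
Proof. by move=> x y xy; rewrite -[x]mul1r -[y]mul1r -!tmult_tens1 xy. Qed.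

End Merge.

(** * The derivation carried by the bracket *)

Section Bracket.
Variables (k : fieldType) (A : algType k) (P : idDTPA A).
Local Notation T := (tpow A).

(** The unit axiom only asserts that [[1, t]] is 1 ⊗ u for some u; merging the
    leading 1 into the next factor gives a formula for u. *)
Definition brDn n (t : T n) : T n := tmerge 0 1 (P 1%N n (tens1 1) t).

Lemma brDn_linear n : linear (@brDn n).
Proof. by move=> c x y; rewrite /brDn linearP /tmerge linearP. Qed.

Lemma br_1 n (t : T n) : (0 < n)%N -> P 1%N n (tens1 1) t = tens1 1 ⊗ brDn t.
Proof.
by move=> n0; rewrite /brDn; have [u ->] := br_unit P t n0; rewrite tens1_tmulK.
Qed.

(** The bracket commutes with permutations of the blocks of its second argument,
    and with 1 as first argument the extra block in front is that 1. *)
Lemma brDn_tau n l (ms : l.-tuple nat) (sigma : 'S_l) (t : T n) :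
  (0 < n)%N -> all (leq 1) ms -> sumn ms = n ->
  brDn (tau ms sigma t) = tau ms sigma (brDn t).
Proof.
move=> n0 ms0 msn; rewrite {1}/brDn (br_taur P) // (br_1 t n0).
by rewrite (tau_lift_tmul ms sigma (tens1 1) (brDn t)) tens1_tmulK.
Qed.

Lemma brDn_castT m n (e : m = n) (t : T m) : brDn (castT e t) = castT e (brDn t).
Proof. by case: _ / e. Qed.

Lemma brDn_swap m n (t : T (m + n)) : (0 < m)%N -> (0 < n)%N ->
  brDn (swap_blocks t) = swap_blocks (brDn t).
Proof.
move=> m0 n0; rewrite /swap_blocks brDn_castT; congr castT.
by apply: brDn_tau; rewrite /= ?m0 ?n0 ?addn0 // addn_gt0 m0.
Qed.

Lemma br_castl m m' n (e : m = m') (e' : (m + n = m' + n)%N) (s : T m) (t : T n) :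
  P m' n (castT e s) t = castT e' (P m n s t).
Proof. by case: _ / e e' => e'; rewrite !castT_id. Qed.

(** The left Leibniz rule at alpha = 1: each of its three terms is the insertion
    of 1 after the factors of s, and this insertion can be cancelled. *)
Lemma br_addD m n (s : T m) (t : T n) : (0 < m)%N -> (0 < n)%N ->
  P m n s t + brDn (s ⊗ t) = 2%:R *: (s ⊗ brDn t).
Proof.
move=> m0 n0; apply: (can_inj (tinsert1K (_ : m < m + n)%N)).
  by rewrite -addn1 leq_add2l.
have mn0 : (0 < m + n)%N by rewrite addn_gt0 m0.
have L : castT (addnS m n) (s ⊗ P 1%N n (tens1 1) t) = tinsert m 1 (s ⊗ brDn t).
  by rewrite (br_1 t n0) (tmul_tens1_tmul 1 s (brDn t)).
have R1 : castT (addnS m n)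
    (castT (esym (addnA m 1 n)) (P (m + 1)%N n (s ⊗ tens1 1) t))
    = tinsert m 1 (P m n s t).
  by rewrite castT_trans -(br_castl (addn1 m)) (tmul_tens1 1 s) (br_insertl P).
have R2 : castT (addnS m n) (castT (addnCA 1 m n)
    (tau [tuple 1%N; m] S2_12 (P 1%N (m + n)%N (tens1 1) (s ⊗ t))))
    = tinsert m 1 (brDn (s ⊗ t)).
  rewrite castT_trans castT_id (br_1 (s ⊗ t) mn0).
  exact: tau_swap_tens1 (leq_addr _ _).
have E := congr1 (castT (addnS m n)) (br_leibnizl P (tens1 1) t s isT n0 m0).
have castL := @castT_linear k A _ _ (addnS m n).
rewrite (linear_funZ _ _ castL) (linear_funD _ _ castL) L R1 R2 in E.
have tL := @tinsert_linear k A (m + n) m 1.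
by rewrite (linear_funD _ _ tL) (linear_funZ _ _ tL) E.
Qed.

Hypothesis two_neq0 : 2%:R != 0 :> k.

(** [br_addD] expresses [[s, t]] and [[t, s]] through D; skew symmetry, together
    with the invariance of D under swapping blocks, makes the brackets cancel in
    the sum of the two expressions. *)
Lemma brDn_tmul m n (s : T m) (t : T n) : (0 < m)%N -> (0 < n)%N ->
  brDn (s ⊗ t) = brDn s ⊗ t + s ⊗ brDn t.
Proof.
move=> m0 n0; apply: (scalerI two_neq0).
have Est := br_addD s t m0 n0; have Ets := br_addD t s n0 m0.
have Dst : swap_blocks (brDn (t ⊗ s)) = brDn (s ⊗ t) :=
  etrans (esym (brDn_swap (t ⊗ s) n0 m0)) (congr1 (@brDn _) (swap_blocks_tmul t s)).
have tDs := swap_blocks_tmul t (brDn s).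
have skew : P m n s t = - swap_blocks (P n m t s) := br_skew P s t m0 n0.
have swL := @swap_blocks_linear k A n m.
(* what remains is a computation in the module, with Est, Ets and skew as the
   only relations and swap_blocks as a linear map *)
move: (P m n s t) (P n m t s) (brDn (t ⊗ s)) (t ⊗ brDn s) (brDn (s ⊗ t))
  (brDn s ⊗ t) (s ⊗ brDn t) Est Ets Dst tDs skew => p q u v x y z.
move=> Est Ets Dst tDs skew.
have E : swap_blocks q + x = 2%:R *: y.
  by rewrite -Dst -tDs -(linear_funD _ _ swL) -(linear_funZ _ _ swL) Ets.
rewrite scalerDr -E -Est skew.
by rewrite addrACA addrN add0r -mulr2n scaler_nat.
Qed.

Lemma brE m n (s : T m) (t : T n) : (0 < m)%N -> (0 < n)%N ->
  P m n s t = s ⊗ brDn t - brDn s ⊗ t.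
Proof.
move=> m0 n0; have := br_addD s t m0 n0; rewrite brDn_tmul // => E.
apply: (addIr (brDn s ⊗ t + s ⊗ brDn t)).
by rewrite E addrA subrK scaler_nat mulr2n.
Qed.

Lemma brDn_tens1 x : brDn (tens1 x) = tens1 (brD P x).
Proof.
rewrite /brD br_1 //.
by elim/tpow1_ind: (brDn _) => y; rewrite tmult_tens1 mul1r.
Qed.

Lemma brD_linear : linear (brD P).
Proof.
move=> c x y; apply: tens1_inj; rewrite tens1_linear -!brDn_tens1.
by rewrite tens1_linear brDn_linear.
Qed.

(** Both sides obey the Leibniz rule for ⊗ and agree in degree one, and a pure
    tensor is its first factor times the others. *)
Lemma brDn_tderive n (t : T n) : (0 < n)%N -> brDn t = tderive (brD P) t.
Proof.
move=> n0; move: t; apply: tpow_linear_eq => [||a].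
- exact: brDn_linear.
- by move=> c x y; rewrite /tderive linearP.
have E1 x : brDn (tens1 x) = tderive (brD P) (tens1 x).
  rewrite brDn_tens1 tderive_pure ?big_ord1; last exact: brD_linear.
  by congr (pure _); apply/ffunP => i; rewrite !ffunE ord1 eqxx.
case: n => [//|n] in n0 a *; elim: n a {n0} => [|n IH] a.
  by rewrite pure_tens1.
rewrite pureS (@brDn_tmul 1 n.+1) // (@tderive_tmul k A (brD P) 1 n.+1).
  by rewrite E1 IH.
exact: brD_linear.
Qed.

(** The bracket commutes with merging the two factors of x ⊗ y, which turns the
    Leibniz rule of D for ⊗ into that of [brD] for the product. *)
Lemma brD_derivation : is_derivation (brD P).
Proof.
split=> [|x y]; first exact: brD_linear.
have := br_merger P (tens1 1) (tens1 x ⊗ tens1 y : T 2) isT (isT : 0 < 1)%N.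
rewrite tmerge_tens1 castT_id !br_1 // brDn_tens1 (@brDn_tmul 1 1) //.
rewrite !brDn_tens1 => /(congr1 (@tmult k A)); rewrite tmult_tens1 mul1r => ->.
have mL : linear (@tmerge k A 2 1 2) by move=> c u v; rewrite /tmerge linearP.
rewrite (linear_funD _ _ (tmul_linearr _)) (linear_funD _ _ mL).
move: (brD P x) (brD P y) => u v.
rewrite (linear_funD _ _ (@tmult_linear k A)).
by congr (_ + _); exact: tmult_tmerge_tens1.
Qed.

End Bracket.

Theorem proposition3p8 (k : closedFieldType) (k_char0 : [pchar k] =i pred0)
    (A : algType k) (P : idDTPA A) :
  is_derivation (brD P) /\
  forall (r s : nat) (alpha : tpow A r) (beta : tpow A s),
    (0 < r)%N -> (0 < s)%N ->
    P r s alpha beta = alpha ⊗ tderive (brD P) beta - tderive (brD P) alpha ⊗ beta.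
Proof.
have two_neq0 : 2%:R != 0 :> k by rewrite ((pcharf0P k).1 k_char0).
split=> [|r s alpha beta r0 s0]; first exact: brD_derivation.
rewrite -(brDn_tderive P two_neq0 alpha r0) -(brDn_tderive P two_neq0 beta s0).
exact: brE.
Qed.
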